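(* Let $k\ge 5$. For any multigraph $G$ of maximum degree $\Delta$ and matching number less than $k$ such that every two of its edges are incident or joined by an edge, the strong clique number of $G$ satisfies $\omega_2'(G)\le (k-\frac12)\Delta$.
   Context: Multigraphs may have parallel edges; degree counts multiplicity. Two edges are incident if they share an endpoint; they are joined by an edge if some edge of $G$ has one endpoint in common with each. A strong clique is a set of edges every two of which are incident or joined by an edge; $\omega_2'(G)$ is the maximum size of a strong clique. The matching number is the maximum size of a set of pairwise non-incident edges. *)

(* Defs.v *)
From mathcomp Require Import all_boot all_order all_algebra.
Set Implicit Arguments.
Unset Strict Implicit.
Unset Printing Implicit Defensive.

(* Finite loopless multigraphs.  Edges are elements of a type of their own, so
   parallel edges are distinct edges with the same set of two endpoints. *)
Record multigraph := Multigraph {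
  vertex : finType;
  edge : finType;
  ends : edge -> {set vertex};
  card_ends : forall e, #|ends e| = 2
}.

Definition degree (G : multigraph) (v : vertex G) : nat :=
  #|[set e : edge G | v \in ends e]|.

Definition max_degree (G : multigraph) : nat :=
  \max_(v : vertex G) degree v.

Definition incident (G : multigraph) : rel (edge G) :=
  fun e f => ends e :&: ends f != set0.

(* The joining edge g ranges over all edges of G. *)
Definition joined (G : multigraph) : rel (edge G) :=
  fun e f => [exists g : edge G, incident e g && incident g f].

Definition strong_clique (G : multigraph) (S : {set edge G}) : bool :=
  [forall e in S, forall f in S, (e != f) ==> (incident e f || joined e f)].

Definition strong_clique_number (G : multigraph) : nat :=
  \max_(S : {set edge G} | strong_clique S) #|S|.

Definition matching (G : multigraph) (S : {set edge G}) : bool :=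
  [forall e in S, forall f in S, (e != f) ==> ~~ incident e f].

Definition matching_number (G : multigraph) : nat :=
  \max_(S : {set edge G} | matching S) #|S|.

(* Main.v *)
(* The clique condition is inherited by induced subgraphs.  If deleting some
   vertex decreases the matching number nu, induct: at most Delta edges are
   lost.  Otherwise, as in the proof of Gallai's lemma, the relation "no maximum
   matching misses both u and v" is transitive; it contains adjacency, and the
   clique condition makes the non-isolated vertices connected, so a maximum
   matching misses at most one of them.  Hence there are at most 2 nu + 1
   non-isolated vertices, and 2 |E| <= (2 nu + 1) Delta by counting degrees. *)
Require Import Defs.
From mathcomp Require Import all_boot all_order all_algebra.
From mathcomp Require Import zify lra.
Set Implicit Arguments.
Unset Strict Implicit.
Unset Printing Implicit Defensive.
Import Order.TTheory GRing.Theory Num.Theory.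
Local Open Scope ring_scope.

Section Matchings.
Local Open Scope nat_scope.
Variable G : multigraph.
Implicit Types (A : {set vertex G}) (S T M N : {set edge G}) (e f g : edge G)
  (u v x y : vertex G).

(** Induced subgraphs are encoded by vertex sets of the fixed [G], so deleting a vertex only shrinks
    [A] and degrees remain bounded by those of [G]. *)
Definition inner A : {set edge G} := [set e | ends e \subset A].

Definition cov S : {set vertex G} := \bigcup_(e in S) ends e.

Definition maximum_in A M : bool :=
  [&& M \subset inner A, matching M &
    [forall S : {set edge G}, (S \subset inner A) && matching S ==> (#|S| <= #|M|)]].

(** * Incidence, matchings and covered vertices *)

Lemma incidentP e f :
  reflect (exists2 x, x \in ends e & x \in ends f) (incident e f).
Proof.
rewrite /incident; apply: (iffP (set0Pn _)) => [[x /setIP[xe xf]]|[x xe xf]]; exists x => //.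
by rewrite inE xe.
Qed.

Lemma covP S x : reflect (exists2 e, e \in S & x \in ends e) (x \in cov S).
Proof. by apply: (iffP bigcupP) => -[e]; exists e. Qed.

Lemma matchingP S :
  reflect (forall e f x, e \in S -> f \in S -> x \in ends e -> x \in ends f -> e = f)
          (matching S).
Proof.
apply: (iffP forall_inP) => [H e f x eS fS xe xf | H e eS].
  apply: contraTeq isT => ef.
  by have /forall_inP/(_ f fS)/implyP/(_ ef)/incidentP[] := H e eS; exists x.
apply/forall_inP => f fS; apply/implyP; apply: contra => /incidentP[x xe xf].
by rewrite (H e f x).
Qed.

Lemma sub_matching S T : S \subset T -> matching T -> matching S.
Proof.
move=> /subsetP ST /matchingP H; apply/matchingP => e f x eS fS.
by apply: H; apply: ST.
Qed.

Lemma matchingU1 S e :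
  matching S -> [disjoint ends e & cov S] -> matching (e |: S).
Proof.
move=> /matchingP H /pred0P dis.
have D f x : f \in S -> x \in ends e -> x \in ends f -> False.
  move=> fS xe xf; have := dis x; rewrite /= xe /= => /negP; apply.
  by apply/covP; exists f.
apply/matchingP => f g x /setU1P[-> | fS] /setU1P[-> | gS] xf xg //.
- by case: (D g x).
- by case: (D f x).
- exact: (H f g x).
Qed.

Lemma ends_eq e u v : u \in ends e -> v \in ends e -> u != v -> ends e = [set u; v].
Proof.
move=> ue ve uv; apply/esym/eqP; rewrite eqEcard card_ends cards2 uv andbT.
by apply/subsetP => x /set2P[] ->.
Qed.

(** Double counting of incidences. It serves both for matchings, where every summand is 1, and for
    the final degree count. *)
Lemma sum_ends S :
  #|S|.*2 = \sum_(v in cov S) #|[set e in S | v \in ends e]|.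
Proof.
have -> : #|S|.*2 = \sum_(e in S) \sum_(v in cov S | v \in ends e) 1.
  rewrite -muln2 -sum_nat_const; apply: eq_bigr => e eS.
  rewrite -(card_ends e) -sum1_card; apply: eq_bigl => v.
  by apply/idP/andP => [ve | []//]; split=> //; apply/covP; exists e.
rewrite (exchange_big_dep (mem (cov S))) /=; last by move=> e v _ /andP[].
apply: eq_bigr => v vS; rewrite -sum1_card; apply: eq_bigl => e.
by rewrite inE vS.
Qed.

Lemma card_cov S : matching S -> #|cov S| = #|S|.*2.
Proof.
move=> /matchingP H; rewrite sum_ends -sum1_card; apply: eq_bigr => v /covP[e eS ve].
apply/esym/eqP/cards1P; exists e; apply/setP => f; rewrite !inE.
by apply/andP/eqP => [[fS vf] | -> //]; apply: (H f e v).
Qed.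

(** * Maximum matchings of an induced subgraph and Gallai's exchange argument *)

Lemma maximum_inP A M :
  reflect [/\ M \subset inner A, matching M &
             forall S, S \subset inner A -> matching S -> #|S| <= #|M|]
          (maximum_in A M).
Proof.
apply: (iffP and3P) => -[MA mM H]; split => //.
  by move=> S SA mS; move/forallP/(_ S): H; rewrite SA mS.
by apply/forallP => S; apply/implyP => /andP[]; apply: H.
Qed.

Lemma exists_maximum A : exists M, maximum_in A M.
Proof.
pose P := [pred S : {set edge G} | (S \subset inner A) && matching S].
have P0 : P set0.
  by rewrite /= sub0set; apply/matchingP => e f x; rewrite inE.
case: (arg_maxnP (P := P) (fun S : {set edge G} => #|S|) P0) => M /andP[MA mM] H.
by exists M; apply/maximum_inP; split=> // S SA mS; apply: H; rewrite /= SA.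
Qed.

Lemma maximum_card A M N : maximum_in A M -> maximum_in A N -> #|M| = #|N|.
Proof.
move=> /maximum_inP[MA mM HM] /maximum_inP[NA mN HN].
by apply/eqP; rewrite eqn_leq HN // HM.
Qed.

(** Otherwise [e] could be added to [M]; it would be a new edge because its set of endpoints is
    nonempty. *)
Lemma maximum_meets A M e :
  maximum_in A M -> e \in inner A -> ~~ [disjoint ends e & cov M].
Proof.
move=> /maximum_inP[MA mM H] eA; apply/negP => dis.
have eM : e \notin M.
  apply/negP => eM; have /card_gt0P[x xe] : 0 < #|ends e| by rewrite card_ends.
  by move/pred0P/(_ x): dis; rewrite /= xe => /covP[]; exists e.
have := H (e |: M); rewrite subUset sub1set eA MA matchingU1 // cardsU1 eM.
by rewrite ltnn => /(_ isT isT).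
Qed.

(* The classical induction on distance in Gallai's lemma becomes transitivity. *)
Definition linked A u v : bool :=
  (u == v) || [forall M, maximum_in A M ==> (u \in cov M) || (v \in cov M)].

Lemma linked_sym A u v : linked A u v = linked A v u.
Proof. by rewrite /linked eq_sym; under eq_forallb do rewrite orbC. Qed.

Lemma linked_edge A e u v : e \in inner A -> u \in ends e -> v \in ends e -> linked A u v.
Proof.
move=> eA ue ve; rewrite /linked; case: eqVneq => //= uv.
apply/forall_inP => M /maximum_meets/(_ eA); rewrite (ends_eq ue ve uv).
by rewrite -setI_eq0 => /set0Pn[x /setIP[/set2P[]->->]]; rewrite ?orbT.
Qed.

Lemma linked_missed A u v M : linked A u v -> u != v -> maximum_in A M ->
  u \notin cov M -> v \in cov M.
Proof.
move=> /orP[/eqP->|/forall_inP H]; first by rewrite eqxx.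
by move=> _ /H/orP[->|].
Qed.

(* Exchange step: an edge xy of M with x missed by N replaces the edge yz of N. *)
Lemma maximum_exchange A M N t x : maximum_in A M -> maximum_in A N ->
  t \notin cov N -> x \in cov M -> x \notin cov N -> x != t ->
  exists N', [/\ maximum_in A N', t \notin cov N' & #|M :\: N'| < #|M :\: N|].
Proof.
move=> maxM maxN tN /covP[e eM xe] xN xt.
have [/maximum_inP[MA mM _] /maximum_inP[NA mN HN]] := (maxM, maxN).
have eA : e \in inner A by apply: (subsetP MA).
have eN : e \notin N by apply: contra xN => eN; apply/covP; exists e.
have := maximum_meets maxN eA.
rewrite -setI_eq0 => /set0Pn[y /setIP[ye yN]].
have xy : x != y by apply: contraNneq xN => ->.
have ty : t != y by apply: contraNneq tN => ->.
have /covP[f fN yf] := yN.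
(* Dropping [f] from [N] thus puts nothing new into [M :\: N], while adding [e] takes [e] out of
   it. *)
have fM : f \notin M.
  apply: contraNN eN => fM.
  by have /matchingP/(_ e f y eM fM ye yf) -> := mM.
have sub : cov (N :\ f) \subset cov N.
  by apply/subsetP => z /covP[g /setD1P[_ gN] zg]; apply/covP; exists g.
have mN' : matching (e |: (N :\ f)).
  apply: matchingU1; first exact: sub_matching (subsetDl _ _) mN.
  rewrite (ends_eq xe ye xy) -setI_eq0; apply/eqP/setP => z; rewrite in_set0.
  apply/negP => /setIP[/set2P[]->].
    by move/(subsetP sub); rewrite (negPf xN).
  move=> /covP[g /setD1P[gf gN] yg]; case/eqP: gf.
  by move/matchingP: mN => /(_ g f y); apply.
have cN' : #|e |: (N :\ f)| = #|N|.
  by rewrite cardsU1 !inE (negPf eN) andbF (cardsD1 f N) fN.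
exists (e |: (N :\ f)); split.
- apply/maximum_inP; split=> //; last by rewrite cN'.
  by rewrite subUset sub1set eA (subset_trans (subsetDl _ _)).
- apply/covP => -[g /setU1P[-> | gN] tg]; last first.
    by case/negP: tN; apply: (subsetP sub); apply/covP; exists g.
  by move: tg; rewrite (ends_eq xe ye xy) !inE eq_sym (negPf xt) (negPf ty).
- apply: proper_card; apply/properP; split.
    apply/subsetP => g; rewrite !inE => /andP[H gM]; rewrite gM andbT.
    apply: contra H => gN; rewrite gN andbT.
    by case: (eqVneq g f) => [gf | _]; rewrite ?orbT //; rewrite -gf gM in fM.
  by exists e; rewrite !inE ?eqxx // eN.
Qed.

(** Descent: suppose [M] misses [u] and [v], and let [N] miss [t]. Exchanges bring [N] ever closer
    to [M] while it keeps missing [t], which cannot go on forever. *)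
Lemma linked_trans A u t v :
  (exists2 N, maximum_in A N & t \notin cov N) ->
  linked A u t -> linked A t v -> linked A u v.
Proof.
move=> [N maxN tN] ut tv; rewrite {1}/linked; case: eqVneq => //= uv.
have [eut|nut] := eqVneq u t.
  apply/forall_inP => M maxM; rewrite eut in uv *.
  by case: (boolP (t \in cov M)) => //=; apply: linked_missed maxM.
have [etv|ntv] := eqVneq t v.
  apply/forall_inP => M maxM; rewrite -etv in uv *.
  by case: (boolP (u \in cov M)) => //=; apply: linked_missed maxM.
apply/forall_inP => M maxM; apply: contraT; rewrite negb_or => /andP[uM vM].
have [n] := ubnP #|M :\: N|.
elim: n N maxN tN => // n IH N maxN tN; rewrite ltnS => le_n.
have uN : u \in cov N.
  by apply: linked_missed maxN tN; [rewrite linked_sym | rewrite eq_sym].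
have vN : v \in cov N by apply: linked_missed maxN tN.
(* [N] misses [t], so it covers [u] and [v]. Both covers have the same size, so [M] covers at least
   two vertices that [N] misses, and one of them is not [t]. *)
have [x xt [xM xN]] : exists2 x, x != t & x \in cov M /\ x \notin cov N.
  have : 1 < #|cov M :\: cov N|.
    have cMN : #|cov M| = #|cov N|.
      move: (maximum_card maxM maxN).
      move: maxM maxN => /maximum_inP[_ mM _] /maximum_inP[_ mN _].
      by rewrite !card_cov // => ->.
    have : #|[set u; v]| <= #|cov N :\: cov M|.
      by apply/subset_leq_card/subsetP => z /set2P[]->; rewrite inE ?uM ?vM ?uN ?vN.
    rewrite cards2 uv; move: (cardsID (cov N) (cov M)) (cardsID (cov M) (cov N)).
    by rewrite setIC; lia.
  move=> /card_gt1P[x [y [/setDP[xM xN] /setDP[yM yN] xy]]].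
  by have [xt|] := eqVneq x t; [exists y; rewrite // -xt eq_sym | exists x].
have [N' [maxN' tN' lt]] := maximum_exchange maxM maxN tN xM xN xt.
by apply: (IH N') => //; apply: leq_trans lt le_n.
Qed.

(** * Edge bounds under the clique condition *)

Hypothesis clique : forall e f, e != f -> incident e f \/ joined e f.

(** The ends of a joining edge are one vertex of [e] and one of [f], so that edge stays inside [A].
    For incident edges, take [g = e] and [x = y]. *)
Lemma joined_inside A e f : e \in inner A -> f \in inner A ->
  exists g x y, [/\ g \in inner A, x \in ends e, y \in ends f & (x \in ends g) && (y \in ends g)].
Proof.
move=> eA fA; have [/incidentP[x xe xf] | nef] := boolP (incident e f).
  by exists e, x, x; rewrite xe.
have ef : e != f.
  apply: contraNneq nef => <-; apply/incidentP.
  by have /card_gt0P[x xe] : 0 < #|ends e| by [rewrite card_ends]; exists x.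
case: (clique ef) => [|/existsP[g /andP[/incidentP[x xe xg] /incidentP[y yg yf]]]].
  by rewrite (negPf nef).
exists g, x, y; split; rewrite ?xg //.
have xy : x != y by apply: contraNneq nef => xy; apply/incidentP; exists x; rewrite // xy.
rewrite inE (ends_eq xg yg xy); rewrite !inE in eA fA.
by apply/subsetP => z /set2P[]->; [apply: (subsetP eA) | apply: (subsetP fA)].
Qed.

Lemma card_inner_degree A v Delta : max_degree G = Delta ->
  #|[set e in inner A | v \in ends e]| <= Delta.
Proof.
move=> <-; apply: leq_trans (leq_bigmax v); apply: subset_leq_card.
by apply/subsetP => e; rewrite !inE => /andP[].
Qed.

Lemma card_cov_inner A M :
  (forall v, v \in A -> exists2 N, maximum_in A N & v \notin cov N) ->
  maximum_in A M -> #|cov (inner A)| <= #|M|.*2.+1.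
Proof.
move=> missed maxM.
have WA v : v \in cov (inner A) -> v \in A.
  by case/covP => e; rewrite inE => /subsetP; apply.
have link u v : u \in cov (inner A) -> v \in cov (inner A) -> linked A u v.
  move=> uW vW; have [[e eA ue] [f fA vf]] := (covP _ _ uW, covP _ _ vW).
  have [g [x [y [gA xe yf /andP[xg yg]]]]] := joined_inside eA fA.
  have xW : x \in cov (inner A) by apply/covP; exists e.
  have yW : y \in cov (inner A) by apply/covP; exists f.
  (* The chain [u], [x], [y], [v] runs along [e], [g], [f]. Consecutive vertices may coincide, which
     [linked] allows by being reflexive. *)
  apply: (linked_trans (missed x (WA x xW)) (linked_edge eA ue xe)).
  apply: (linked_trans (missed y (WA y yW)) (linked_edge gA xg yg)).
  exact: linked_edge fA yf vf.
have [_ mM _] := maximum_inP _ _ maxM.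
rewrite -card_cov // -(cardsID (cov M)) -addn1 leq_add //.
  by rewrite subset_leq_card // subsetIr.
rewrite leqNgt; apply/negP => /card_gt1P[u [v [/setDP[uW uM] /setDP[vW vM] uv]]].
by rewrite (linked_missed (link u v uW vW) uv maxM uM) in vM.
Qed.

(** Induction on the size of [A], split on whether some vertex of [A] is covered by all maximum
    matchings. *)
Lemma card_inner_bound A M Delta : max_degree G = Delta -> maximum_in A M ->
  #|inner A|.*2 <= #|M|.*2.+1 * Delta.
Proof.
move=> hD; have [n] := ubnP #|A|; elim: n A M => // n IH A M; rewrite ltnS => An maxM.
have [/exists_inP[v vA /forall_inP Hv] | Hmiss] :=
  boolP [exists v in A, [forall N, maximum_in A N ==> (v \in cov N)]].
  have [N maxN] := exists_maximum (A :\ v).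
  have sub : inner (A :\ v) \subset inner A.
    by apply/subsetP => e; rewrite !inE subsetD1 => /andP[].
  have [NA mN HN] := maximum_inP _ _ maxN.
  have [MA mM HM] := maximum_inP _ _ maxM.
  (* With equal sizes [N] would be maximum in [A] as well and so cover [v], although its edges avoid
     [v]. *)
  have NM : #|N| < #|M|.
    rewrite ltn_neqAle (HM N (subset_trans NA sub) mN) andbT.
    apply/eqP => cNM.
    have : v \in cov N.
      by apply: Hv; apply/maximum_inP; split=> //; rewrite ?cNM // (subset_trans NA).
    by case/covP => e /(subsetP NA); rewrite inE subsetD1 => /andP[_ /negPf->].
  have cA : #|A :\ v| < n by move: An; rewrite (cardsD1 v A) vA.
  have := IH _ _ cA maxN.
  have : #|inner A| <= #|inner (A :\ v)| + Delta.
    apply: leq_trans (leq_add (leqnn _) (card_inner_degree A v hD)).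
    apply: leq_trans (leq_card_setU _ _); apply/subset_leq_card/subsetP => e.
    by rewrite !inE subsetD1 => ->; rewrite /= orNb.
  (* Losing at most [Delta] edges costs [2 * Delta] on the left; the drop from [M] to [N] pays for
     it on the right. *)
  by move: NM; nia.
apply: leq_trans (leq_mul (card_cov_inner _ maxM) (leqnn Delta)) => [|v vA].
  rewrite sum_ends -sum_nat_const; apply: leq_sum => v _; exact: card_inner_degree.
move: Hmiss; rewrite negb_exists_in => /forall_inP/(_ v vA).
by rewrite negb_forall => /existsP[N]; rewrite negb_imply => /andP[]; exists N.
Qed.

End Matchings.

Theorem theorem7p2 (k : nat) (hk : (5 <= k)%N) (G : multigraph) (Delta : nat)
    (hDelta : max_degree G = Delta)
    (hmatching : (matching_number G < k)%N)
    (hclique : forall e f : edge G, e != f -> incident e f \/ joined e f) :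
  (strong_clique_number G)%:R <= (k%:R - 1 / 2%:R) * Delta%:R :> rat.
Proof.
have [M maxM] := exists_maximum [set: vertex G].
have Mk : (#|M| < k)%N.
  apply: leq_ltn_trans hmatching; have [_ mM _] := maximum_inP _ _ maxM.
  exact: leq_bigmax_cond.
have omega : (strong_clique_number G <= #|inner [set: vertex G]|)%N.
  apply/bigmax_leqP => S _; apply/subset_leq_card/subsetP => e _.
  by rewrite inE subsetT.
have bound := card_inner_bound hclique hDelta maxM.
(* Doubling and moving [Delta] to the left states the bound in [nat]. Since [#|M| + 1 <= k], it
   follows from [(2 * #|M| + 1) * Delta + Delta <= 2 * k * Delta]. *)
have : ((strong_clique_number G).*2 + Delta <= k.*2 * Delta)%N by nia.
rewrite -(ler_nat rat) natrD natrM -!muln2 !natrM; lra.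
Qed.
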